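(* Let $p$ be an odd prime, let $q\in\mathbb{C}_p$ with $|1-q|_p<p^{-\frac{1}{p-1}}$, and let $x\in\mathbb{Z}_p$. For every integer $n\geq0$, \[ \mathcal{E}_{n,q}(x)=\sum_{k=0}^n Ch_{k,q}(x)\,S_2(n,k). \]
   Context: For $x\in\mathbb{Z}_p$, $[x]_q=\frac{q^x-1}{q-1}$. The fermionic $p$-adic $q$-integral of a continuous $f:\mathbb{Z}_p\to\mathbb{C}_p$ is $\int_{\mathbb{Z}_p}f(y)\,d\mu_{-q}(y)=\lim_{N\to\infty}\frac{1}{[p^N]_{-q}}\sum_{y=0}^{p^N-1}f(y)(-q)^y$, where $[m]_{-q}=\frac{1-(-q)^m}{1+q}$. The Carlitz $q$-Euler polynomials are $\mathcal{E}_{n,q}(x)=\int_{\mathbb{Z}_p}[x+y]_q^n\,d\mu_{-q}(y)$. The Carlitz-type $q$-Changhee polynomials $Ch_{n,q}(x)$ are defined by $\int_{\mathbb{Z}_p}(1+t)^{[x+y]_q}\,d\mu_{-q}(y)=\sum_{n\ge0}Ch_{n,q}(x)\frac{t^n}{n!}$ for $t\in\mathbb{C}_p$ with $|t|_p<p^{-\frac{1}{p-1}}$. $S_2(n,k)$ are the Stirling numbers of the second kind, $\frac{(e^t-1)^k}{k!}=\sum_{n\ge k}S_2(n,k)\frac{t^n}{n!}$. *)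

(* Defs.v *)
From HB Require Import structures.
From mathcomp Require Import all_boot all_order all_algebra.
From mathcomp Require Import all_classical all_reals all_analysis.

Set Implicit Arguments.
Unset Strict Implicit.
Unset Printing Implicit Defensive.

Import Order.TTheory GRing.Theory Num.Theory.

Local Open Scope classical_set_scope.
Local Open Scope ring_scope.

(* A field with a nonarchimedean absolute value.  MathComp's [normedZmodType]
   cannot express this: it requires `|x *+ n| = `|x| *+ n. *)
Record ultraField (R : realType) := UltraField {
  ultra_carrier : fieldType;
  ultra_abs : ultra_carrier -> R;
  ultra_abs_ge0 : forall x, 0 <= ultra_abs x;
  ultra_abs_eq0 : forall x, ultra_abs x = 0 <-> x = 0;
  ultra_absM : forall x y, ultra_abs (x * y) = ultra_abs x * ultra_abs y;
  ultra_absD : forall x y,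
    ultra_abs (x + y) <= Num.max (ultra_abs x) (ultra_abs y)
}.

(* The carrier, under a name of its own so that the metric structure given by
   the absolute value can be attached to it. *)
Definition ultra_sort (R : realType) (K : ultraField R) : Type :=
  ultra_carrier K.
Coercion ultra_sort : ultraField >-> Sortclass.

Section UltraMetric.
Context {R : realType} {K : ultraField R}.

HB.instance Definition _ := GRing.Field.copy K (ultra_carrier K).

Definition uabs (x : K) : R := ultra_abs x.

Let udist (x y : K) : R := uabs (x - y).

Let uabsN (x : K) : uabs (- x) = uabs x.
Proof.
have h1 : uabs 1 = 1.
  have /eqP := ultra_absM (1 : K) 1; rewrite mulr1 -/(uabs 1).
  have n0 : uabs 1 != 0 by apply/eqP => /ultra_abs_eq0/eqP; rewrite oner_eq0.
  by rewrite -[eqbLHS]mulr1 => /eqP/(mulfI n0).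
have hN1 : uabs (- 1) = 1.
  have sq : uabs (- 1) ^+ 2 = 1.
    by rewrite expr2 /uabs -ultra_absM mulrNN mulr1 -/(uabs 1).
  apply/eqP; rewrite -(@eqrXn2 _ 2) // ?expr1n ?sq //.
  exact: ultra_abs_ge0.
by rewrite -mulN1r /uabs ultra_absM -!/(uabs _) hN1 mul1r.
Qed.

Let udistxx x : udist x x = 0.
Proof. by rewrite /udist subrr; apply/ultra_abs_eq0. Qed.

Let udist_eq0 x y : udist x y = 0 -> x = y.
Proof. by move=> /ultra_abs_eq0/eqP; rewrite subr_eq0 => /eqP. Qed.

Let udistC x y : udist x y = udist y x.
Proof. by rewrite /udist -uabsN opprB. Qed.

Let udist_triangle y x z : udist x z <= udist x y + udist y z.
Proof.
rewrite /udist -[x in x - z](subrK y) -addrA.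
apply: le_trans (ultra_absD _ _) _; rewrite -!/(uabs _).
by rewrite ge_max lerDl lerDr !ultra_abs_ge0.
Qed.

HB.instance Definition _ := isMetric.Build R K
  udistxx udist_eq0 udistC udist_triangle.

HB.instance Definition _ := isPointed.Build K 0.

(* When |p| = 1/p and K is complete, the closure of the prime field is the
   completion of the rationals for the p-adic absolute value. *)
Definition Qp_in : set K := closure (range (@ratr K)).

Definition Zp_in : set K := [set x | Qp_in x /\ uabs x <= 1].

Definition Qp_poly (P : {poly K}) : Prop := forall i, Qp_in P`_i.

Definition Qp_algebraic : set K :=
  [set x | exists P : {poly K}, [/\ Qp_poly P, P != 0 & root P x]].

End UltraMetric.

(* K is C_p, the completion of an algebraic closure of Q_p, with the absolute
   value normalized by |p| = 1/p.  Every nonconstant polynomial over Q_p has a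
   root in K, so the elements of K algebraic over Q_p form an algebraic closure
   of Q_p; they are dense in K, and K is complete.  This determines K up to
   isometric isomorphism. *)
Record is_padic_complex (R : realType) (p : nat) (K : ultraField R) : Prop := {
  padic_abs_p : uabs (p%:R : K) = (p%:R : R)^-1;
  padic_complete : forall F : set_system K, ProperFilter F -> cauchy F -> cvg F;
  padic_alg_closed : forall P : {poly K},
    Qp_poly P -> (1 < size P)%N -> exists x : K, root P x;
  padic_alg_dense : dense (Qp_algebraic : set K)
}.

(* p^(-1/(p-1)) *)
Definition exp_radius (R : realType) (p : nat) : R :=
  (p%:R : R) `^ (- ((p.-1)%:R)^-1).

Section Changhee.
Context {R : realType} {K : ultraField R}.
Implicit Types (q t u x z : K) (f : K -> K).

Definition uexp z : K := limn (series (fun n => z ^+ n / n`!%:R)).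

Definition ulog u : K :=
  limn (series (fun n => (-1) ^+ n * (u - 1) ^+ n.+1 / n.+1%:R)).

(* u^z = exp (z log u), used for |u - 1| < p^(-1/(p-1)) and |z| <= 1 *)
Definition upow u z : K := uexp (z * ulog u).

(* [x]_q, with the limit value [x]_1 = x *)
Definition qnumber q x : K := if q == 1 then x else (upow q x - 1) / (q - 1).

(* [m]_{-q} *)
Definition qnumberN q (m : nat) : K := (1 - (- q) ^+ m) / (1 + q).

(* The integral of f over Z_p against mu_{-q}; only the restriction of f to
   Z_p (indeed to the natural numbers) matters. *)
Definition fermionic_int (p : nat) q f : K :=
  limn (fun N => (qnumberN q (p ^ N))^-1 *
                 \sum_(0 <= y < p ^ N) f y%:R * (- q) ^+ y).

Definition qEuler (p n : nat) q x : K :=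
  fermionic_int p q (fun y => qnumber q (x + y) ^+ n).

Definition qChanghee_gen (p : nat) q x : set (nat -> K) :=
  [set c | forall t, uabs t < exp_radius R p ->
    series (fun n => c n * (t ^+ n / n`!%:R)) @ \oo -->
      fermionic_int p q (fun y => upow (1 + t) (qnumber q (x + y)))].

(* the coefficient sequence determined by the generating function *)
Definition qChanghee (p n : nat) q x : K := get (qChanghee_gen p q x) n.

(* n! times the coefficient of t^n in (e^t - 1)^k / k!; cutting e^t - 1 after
   degree n does not affect this coefficient. *)
Definition Stirling2 (n k : nat) : K :=
  n`!%:R / k`!%:R *
  ((\sum_(1 <= i < n.+1) (i`!%:R)^-1 *: 'X^i : {poly K}) ^+ k)`_n.

End Changhee.

(* Main.v *)
Require Import Defs.
From mathcomp Require Import all_boot all_order all_algebra.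
From mathcomp Require Import all_classical all_reals all_analysis.
From mathcomp Require Import ring.

(* Write (a)_n for the falling factorial and a_y = [x + y]_q.  For |a| <= 1 and
   |t| < p^(-1/(p-1)) one has (1 + t)^a = sum_n (a)_n t^n / n!, uniformly in a.
   All functions of y met here are bounded by 1 and satisfy
   |f (y + m) - f y| <= |m|; for these the fermionic integral converges and does
   not increase the sup norm, so the series may be integrated termwise, which
   gives Ch_n = int (a_y)_n by uniqueness of power series coefficients.
   Integrating a^n = sum_k S_2(n, k) (a)_k yields the theorem. *)

Set Implicit Arguments.
Unset Strict Implicit.
Unset Printing Implicit Defensive.

Import Order.TTheory GRing.Theory Num.Theory.
Import numFieldNormedType.Exports.

Local Open Scope classical_set_scope.
Local Open Scope ring_scope.

(** * Formal identities *)

(** The delicate point is a Lipschitz constant. Dividing [upow q y - 1] by [q - 1] leaves a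
    1-Lipschitz function only if [upow q] has constant |q - 1|. That needs |t^n / n!| <= |t| for n
    >= 1, hence the bound n - 1, rather than n, for (p - 1) v_p(n!). The same bound yields |t^n /
    n!| <= (|t| / r)^n with r = p^(-1/(p-1)), so the exponential, logarithmic and binomial series
    have a geometric majorant, and exchanging limits comes down to finite sums with an explicit
    error. Since [upow] is defined through exp and log, its binomial expansion is the link to
    falling factorials; it is obtained coefficientwise in z, without exp (log u) = u or the addition
    law of exp. Oddness of p makes 2 a unit, so that the normalizers [p^N]_{-q} have absolute value
    1, and makes p alternating signs sum to 1, so that the sums defining the integral are Cauchy. *)

Lemma logn_fact_le p n : prime p -> (p.-1 * logn p n`! <= n.-1)%N.
Proof.
move=> p_pr; have p_gt1 := prime_gt1 p_pr; have p_gt0 := prime_gt0 p_pr.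
have [->|n_gt0] := posnP n; first by rewrite logn1 muln0.
(* Legendre's sum telescopes because p * floor(n / p^(k+1)) <= floor(n / p^k). *)
have H k : (p.-1 * \sum_(1 <= i < k.+1) n %/ p ^ i + n %/ p ^ k <= n)%N.
  elim: k => [|k IHk]; first by rewrite big_geq // muln0 expn0 divn1.
  apply: leq_trans IHk; rewrite big_nat_recr //= mulnDr -addnA leq_add2l.
  by rewrite -mulSnr prednK // expnSr divnMA mulnC leq_trunc_div.
(* For this [k] the leftover term [n %/ p ^ k] of [H] is at least 1, which turns n into n - 1. *)
set k := trunc_log p n; have pk_le_n : (p ^ k <= n)%N by exact: trunc_logP.
have k_le_n : (k <= n)%N by exact: leq_trans (ltnW (ltn_expl k p_gt1)) pk_le_n.
rewrite logn_fact // (@big_cat_nat _ _ _ k.+1) //=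
  [X in (_ + X)%N]big_nat_cond [X in (_ + X)%N]big1.
  rewrite addn0 -ltnS prednK //; apply: leq_trans (H k).
  by rewrite -addn1 leq_add2l divn_gt0 ?expn_gt0 ?p_gt0.
move=> i /andP[/andP[lt_ki _] _]; rewrite divn_small //.
by apply: leq_trans (trunc_log_ltn n p_gt1) _; rewrite leq_exp2l.
Qed.

Section FormalIdentities.
Variable F : fieldType.
Hypothesis charF : [pchar F] =i pred0.

Let natf_eq0 n : (n%:R == 0 :> F) = (n == 0)%N.
Proof. by move/pcharf0P: charF => ->. Qed.

Let fact_neq0 n : n`!%:R != 0 :> F.
Proof. by rewrite natf_eq0 -lt0n fact_gt0. Qed.

Definition ffact_poly n : {poly F} := \prod_(i < n) ('X - i%:R%:P).

Definition bin_poly n : {poly F} := n`!%:R^-1 *: ffact_poly n.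

Lemma ffact_polyS n : ffact_poly n.+1 = ffact_poly n * ('X - n%:R%:P).
Proof. by rewrite /ffact_poly big_ord_recr. Qed.

Lemma size_ffact_poly n : size (ffact_poly n) = n.+1.
Proof.
by rewrite /ffact_poly size_prod_XsubC /index_enum -enumT size_enum_ord.
Qed.

Lemma ffact_poly_nat m n : (ffact_poly n).[m%:R] = (m ^_ n)%:R.
Proof.
elim: n => [|n IHn]; first by rewrite /ffact_poly big_ord0 hornerC.
rewrite ffact_polyS hornerM IHn hornerXsubC ffactnSr.
have [lt_mn|le_nm] := ltnP m n; first by rewrite ffact_small ?mul0n ?mul0r.
by rewrite natrM natrB.
Qed.

Lemma bin_poly_nat m n : (bin_poly n).[m%:R] = 'C(m, n)%:R.
Proof.
by rewrite hornerZ ffact_poly_nat -bin_ffact natrM mulrC mulfK.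
Qed.

Lemma bin_polyS n : n.+1%:R *: bin_poly n.+1 = bin_poly n * ('X - n%:R%:P).
Proof.
rewrite /bin_poly ffact_polyS -scalerAl scalerA; congr (_ *: _).
by rewrite factS natrM invfM mulrA mulfV ?mul1r // natf_eq0.
Qed.

(* d/dz (1 + t)^z = log(1 + t) (1 + t)^z, read on the coefficients of t^n *)
Lemma deriv_bin_poly n :
  (bin_poly n)^`() =
    \sum_(i < n) ((-1) ^+ (n - i.+1) / (n - i)%:R) *: bin_poly i.
Proof.
elim: n => [|n IHn].
  by rewrite big_ord0 /bin_poly /ffact_poly big_ord0 linearZ /= derivC scaler0.
have n1 : n.+1%:R != 0 :> F by rewrite natf_eq0.
apply: (scalerI n1); rewrite -linearZ /= bin_polyS derivM IHn derivXsubC mulr1.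
rewrite mulr_suml scaler_sumr.
pose c i : F := (-1) ^+ (n - i) / (n.+1 - i)%:R.
have step (i : 'I_n) :
  (((-1) ^+ (n - i.+1) / (n - i)%:R) *: bin_poly i) * ('X - n%:R%:P) =
  (c i.+1 * i.+1%:R) *: bin_poly i.+1 + (-1) ^+ (n - i) *: bin_poly i.
  have ni : (n - i)%:R != 0 :> F by rewrite natf_eq0 subn_eq0 -ltnNge.
  (* The factor X - i raises the index of [bin_poly i] by [bin_polyS]; the constant n - i cancels
     the denominator. *)
  have -> : 'X - n%:R%:P = ('X - i%:R%:P) - (n - i)%:R%:P :> {poly F}.
    by rewrite natrB ?(ltnW (ltn_ord i)) // polyCB opprB addrA subrK.
  rewrite -scalerAl mulrBr -bin_polyS scalerBr scalerA /c subSS; congr (_ + _).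
  rewrite [bin_poly i * _]mulrC mul_polyC scalerA divfK // -scaleNr.
  by rewrite -[(n - i)%N]prednK ?subn_gt0 // subnS exprS mulN1r.
rewrite (eq_bigr _ (fun i _ => step i)) big_split /= -addrA.
have -> : \sum_(i < n) (-1) ^+ (n - i) *: bin_poly i + bin_poly n =
    \sum_(i < n.+1) (-1) ^+ (n - i) *: bin_poly i.
  by rewrite big_ord_recr /= subnn scale1r.
have -> : \sum_(i < n) (c i.+1 * i.+1%:R) *: bin_poly i.+1 =
    \sum_(i < n.+1) (c i * i%:R) *: bin_poly i.
  by rewrite big_ord_recl /= mulr0 scale0r add0r.
rewrite -big_split; apply: eq_bigr => i _ /=.
rewrite -scalerDl [RHS]scalerA subSS; congr (_ *: bin_poly i).
have ni : (n.+1 - i)%:R != 0 :> F by rewrite natf_eq0 subn_eq0 -ltnNge.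
have -> : n.+1%:R = i%:R + (n.+1 - i)%:R :> F by rewrite -natrD subnKC // ltnW.
by rewrite mulrDl /c; congr (_ + _); rewrite mulrC ?divfK.
Qed.

Definition trunc_expm1 n : {poly F} := \sum_(1 <= i < n.+1) i`!%:R^-1 *: 'X^i.

(** Up to degree n this is e^(mt), obtained from the binomial convolution without formal power
    series. *)
Let coef_trunc_exp n m i : (i <= n)%N ->
  ((1 + trunc_expm1 n) ^+ m)`_i = m%:R ^+ i / i`!%:R.
Proof.
have coef_exp j : (j <= n)%N -> (1 + trunc_expm1 n)`_j = j`!%:R^-1.
  have -> : 1 + trunc_expm1 n = \poly_(j < n.+1) j`!%:R^-1.
    rewrite poly_def -(big_mkord xpredT (fun j => j`!%:R^-1 *: 'X^j)).
    by rewrite big_ltn // fact0 invr1 scale1r expr0.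
  by rewrite coef_poly ltnS => ->.
elim: m i => [|m IHm] i le_in.
  by rewrite expr0 coef1 expr0n; case: i le_in => [|i] _; rewrite ?mul0r ?divr1.
rewrite exprSr coefM -nat1r [(1 + m%:R) ^+ i]exprDn mulr_suml.
apply: eq_bigr => j _.
have le_ji : (j <= i)%N by rewrite -ltnS.
rewrite IHm ?coef_exp ?(leq_trans (leq_subr _ _)) ?(leq_trans le_ji) //.
rewrite expr1n mul1r -[X in _ = X / _]mulr_natr -!mulrA; congr (_ * _).
rewrite -invfM -natrM -(bin_fact le_ji) [in RHS]natrM invfM mulrA.
rewrite mulfV ?mul1r //.
by rewrite natf_eq0 -lt0n bin_gt0.
Qed.

Let coef_trunc_expm1_small n k : (n < k)%N -> (trunc_expm1 n ^+ k)`_n = 0.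
Proof.
move=> lt_nk; have [Q ->] : exists Q, trunc_expm1 n = 'X * Q.
  exists (\sum_(1 <= i < n.+1) i`!%:R^-1 *: 'X^(i.-1)).
  rewrite mulr_sumr; apply: eq_big_nat => i /andP[i_gt0 _].
  by rewrite -scalerAr -exprS prednK.
by rewrite exprMn coefXnM lt_nk.
Qed.

(** Both sides agree at every natural number m: expanding e^(mt) = (1 + (e^t - 1))^m and reading off
    n! times the coefficient of t^n gives m^n. In characteristic 0 this is more roots than the
    difference can have. The coefficients are those of [Stirling2], by unfolding. *)
Lemma expr_ffact_poly n :
  'X^n = \sum_(k < n.+1)
    (n`!%:R / k`!%:R * (trunc_expm1 n ^+ k)`_n) *: ffact_poly k.
Proof.
apply/eqP; rewrite -subr_eq0; apply/eqP.
set P := _ - _.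
pose rs : seq F := [seq i%:R | i <- iota 0 (size P)].
apply: (@roots_geq_poly_eq0 _ _ rs).
- apply/allP => _ /mapP[m _ ->]; rewrite rootE /P !hornerE horner_sum subr_eq0.
  have := coef_trunc_exp m (leqnn n).
  rewrite exprDn coef_sum => /esym/(canRL (divfK (fact_neq0 n))) ->.
  (* The binomial sum stops at m, the Stirling sum at n. Both are extended to m + n: [c k] vanishes
     for k > m by the binomial and for k > n since X divides [trunc_expm1 n]. *)
  pose c k : F := 'C(m, k)%:R * (trunc_expm1 n ^+ k)`_n.
  have -> : \sum_(k < m.+1) (1 ^+ (m - k) * trunc_expm1 n ^+ k *+ 'C(m, k))`_n =
      \sum_(k < (m + n).+1) c k.
    rewrite (big_ord_widen (m + n).+1 (fun k =>
      (1 ^+ (m - k) * trunc_expm1 n ^+ k *+ 'C(m, k))`_n)) ?ltnS ?leq_addr //.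
    rewrite big_mkcond; apply: eq_bigr => k _ /=.
    rewrite expr1n mul1r coefMn /c mulr_natl; case: ifP => // /negbT.
    by rewrite -leqNgt => lt_mk; rewrite bin_small.
  have -> : \sum_(k < (m + n).+1) c k = \sum_(k < n.+1) c k.
    rewrite [RHS](big_ord_widen (m + n).+1) ?ltnS ?leq_addl //.
    rewrite [RHS]big_mkcond; apply: eq_bigr => k _ /=; case: ifP => // /negbT.
    by rewrite -leqNgt => lt_nk; rewrite /c coef_trunc_expm1_small ?mulr0.
  rewrite mulr_suml; apply/eqP; apply: eq_bigr => k _.
  rewrite hornerZ ffact_poly_nat /c -bin_ffact natrM.
  have := fact_neq0 k; move: (k`!%:R : F) => u u_neq0; by field.
- rewrite map_inj_in_uniq ?iota_uniq // => i j _ _.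
  have le_of_eq (a b : nat) : a%:R = b%:R :> F -> (a <= b)%N.
    move=> ab; rewrite leqNgt; apply/negP => lt_ba.
    have : (a - b)%:R == 0 :> F by rewrite natrB ?ab ?subrr // ltnW.
    by rewrite natf_eq0 subn_eq0 leqNgt lt_ba.
  by move=> ij; apply/eqP; rewrite eqn_leq !le_of_eq.
by rewrite size_map size_iota.
Qed.
End FormalIdentities.

(** * Sequences and series in ultrametric fields *)

Section UltrametricAnalysis.
Context {R : realType} {K : ultraField R}.
Implicit Types (x y z s : K) (u v : nat -> K) (t B : R).

Lemma uabs_ge0 x : 0 <= uabs x. Proof. exact: ultra_abs_ge0. Qed.

Lemma uabsM x y : uabs (x * y) = uabs x * uabs y.
Proof. exact: ultra_absM. Qed.

Lemma uabsD_le x y B : uabs x <= B -> uabs y <= B -> uabs (x + y) <= B.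
Proof.
by move=> xB yB; apply: le_trans (ultra_absD _ _) _; rewrite ge_max xB.
Qed.

Lemma uabs_eq0 x : (uabs x == 0) = (x == 0).
Proof. by apply/eqP/eqP => /ultra_abs_eq0. Qed.

Lemma uabs0 : uabs (0 : K) = 0. Proof. by apply/eqP; rewrite uabs_eq0. Qed.

Lemma uabs1 : uabs (1 : K) = 1.
Proof.
have n0 : uabs (1 : K) != 0 by rewrite uabs_eq0 oner_eq0.
by apply: (mulfI n0); rewrite -uabsM !mulr1.
Qed.

Lemma uabsX x n : uabs (x ^+ n) = uabs x ^+ n.
Proof. by elim: n => [|n IHn]; rewrite ?expr0 ?uabs1 // !exprS uabsM IHn. Qed.

Lemma uabsN x : uabs (- x) = uabs x.
Proof.
rewrite -mulN1r uabsM [uabs (-1)](_ : _ = 1) ?mul1r //.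
apply: (@pexpIrn _ 2); rewrite ?nnegrE ?uabs_ge0 //.
by rewrite -uabsX sqrrN !expr1n uabs1.
Qed.

Lemma uabsV x : uabs x^-1 = (uabs x)^-1.
Proof.
have [->|x0] := eqVneq x 0; first by rewrite invr0 uabs0 invr0.
have a0 : uabs x != 0 by rewrite uabs_eq0.
by apply: (mulfI a0); rewrite -uabsM !mulfV // uabs1.
Qed.

Lemma uabsB x y : uabs (x - y) = uabs (y - x).
Proof. by rewrite -uabsN opprB. Qed.

Lemma uabsB_le x y B : uabs x <= B -> uabs y <= B -> uabs (x - y) <= B.
Proof. by move=> xB yB; apply: uabsD_le; rewrite ?uabsN. Qed.

Lemma uabs_triangle y x z B :
  uabs (x - y) <= B -> uabs (y - z) <= B -> uabs (x - z) <= B.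
Proof. by move=> xy /(uabsD_le xy); rewrite addrA subrK. Qed.

Lemma uabs_sum_le (I : eqType) (r : seq I) (P : pred I) (F : I -> K) B :
  0 <= B -> (forall i, i \in r -> P i -> uabs (F i) <= B) ->
  uabs (\sum_(i <- r | P i) F i) <= B.
Proof.
move=> B0 FB; rewrite big_seq_cond.
elim/big_ind: _ => [|x y|i /andP[]];
  [by rewrite uabs0 | exact: uabsD_le | exact: FB].
Qed.

Lemma uabs_nat_le1 n : uabs (n%:R : K) <= 1.
Proof.
by elim: n => [|n IHn]; rewrite ?uabs0 // -natr1 uabsD_le ?uabs1.
Qed.

Lemma uabs_near1 x : uabs (x - 1) < 1 -> uabs x = 1.
Proof.
move=> x1; apply/eqP; rewrite eq_le; apply/andP; split.
  by rewrite -[x](subrK 1) uabsD_le ?uabs1 // ltW.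
rewrite leNgt; apply/negP => lt_x1.
suff: uabs (1 : K) < 1 by rewrite uabs1 ltxx.
rewrite -[1 in X in X < _](subrK x); apply: le_lt_trans (ultra_absD _ _) _.
by rewrite gt_max lt_x1 andbT; change (uabs (1 - x) < 1); rewrite uabsB.
Qed.

Lemma ucvgP u s : u @ \oo --> s <->
  forall e : R, 0 < e -> \forall n \near \oo, uabs (s - u n) < e.
Proof. exact: (@metricType_numDomainType.cvgrPdist_lt R K). Qed.

Lemma ucvg_lim u s : u @ \oo --> s -> limn u = s.
Proof. by move/cvg_lim; apply; exact: metric_hausdorff. Qed.

(** Used throughout to carry a bound on finite sums over to their limit. *)
Lemma ucvg_ball N B a u s :
  (forall n, (N <= n)%N -> uabs (u n - a) <= B) -> u @ \oo --> s ->
  uabs (s - a) <= B.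
Proof.
move=> uB us; apply/ler_addgt0Pl => e e0.
have [M _ HM] := (ucvgP u s).1 us _ e0.
have H0 : 0 <= B by apply: le_trans (uB N (leqnn _)); exact: uabs_ge0.
apply: (@uabs_triangle (u (maxn N M))).
  by apply: le_trans (ltW (HM _ (leq_maxr _ _))) _; rewrite lerDl.
by apply: le_trans (uB _ (leq_maxl _ _)) _; rewrite lerDr ltW.
Qed.

Lemma ucvg_unique u s s' : u @ \oo --> s -> u @ \oo --> s' -> s = s'.
Proof. by move=> /ucvg_lim <- /ucvg_lim <-. Qed.

Lemma ucvg_dominated (v : nat -> R) u s :
  (forall n, uabs (s - u n) <= v n) -> v @ \oo --> (0 : R) -> u @ \oo --> s.
Proof.
move=> uv v0; apply/ucvgP => e e0.
near=> n; apply: le_lt_trans (uv n) _; apply: le_lt_trans (ler_norm _) _.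
by near: n; move/cvgr0Pnorm_lt: v0; apply.
Unshelve. all: by end_near. Qed.

Lemma ucvg_geometric t B u s : 0 <= t < 1 ->
  (forall n, uabs (s - u n) <= B * t ^+ n) -> u @ \oo --> s.
Proof.
move=> /andP[t0 t1] H; apply: ucvg_dominated H _.
rewrite -[X in _ --> X](mulr0 B); apply: cvgM; first exact: cvg_cst.
by apply: cvg_expr; rewrite ger0_norm.
Qed.

Lemma ucvgD u v s s' : u @ \oo --> s -> v @ \oo --> s' ->
  (fun n => u n + v n) @ \oo --> s + s'.
Proof.
move=> /ucvgP us /ucvgP vs; apply/ucvgP => e e0; near=> n.
rewrite opprD addrACA; apply: le_lt_trans (ultra_absD _ _) _.
by rewrite gt_max; apply/andP; split; near: n; [exact: us|exact: vs].
Unshelve. all: by end_near. Qed.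

Lemma ucvgZ x u s : u @ \oo --> s -> (fun n => x * u n) @ \oo --> x * s.
Proof.
move=> /ucvgP us; have [->|x0] := eqVneq x 0.
  apply/ucvgP => e e0; near=> n; by rewrite !mul0r subr0 uabs0.
have ax0 : 0 < uabs x by rewrite lt_neqAle uabs_ge0 eq_sym uabs_eq0 x0.
apply/ucvgP => e e0; near=> n.
rewrite -mulrBr uabsM -ltr_pdivlMl //; near: n; apply: us.
by rewrite mulr_gt0 ?invr_gt0.
Unshelve. all: by end_near. Qed.

Lemma ucvgB u v s s' : u @ \oo --> s -> v @ \oo --> s' ->
  (fun n => u n - v n) @ \oo --> s - s'.
Proof.
move=> us /(@ucvgZ (-1)); rewrite mulN1r; under eq_fun do rewrite mulN1r.
exact: ucvgD.
Qed.

Lemma ucvg_cst s : (fun=> s) @ \oo --> s.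
Proof. by apply/ucvgP => e e0; near=> n; rewrite subrr uabs0.
Unshelve. all: by end_near. Qed.

Lemma ucvg_sum (I : Type) (r : seq I) (u : I -> nat -> K) (s : I -> K) :
  (forall i, u i @ \oo --> s i) ->
  (fun n => \sum_(i <- r) u i n) @ \oo --> \sum_(i <- r) s i.
Proof.
move=> us; elim: r => [|i r IHr].
  rewrite big_nil; under eq_fun do rewrite big_nil; exact: ucvg_cst.
rewrite big_cons; under eq_fun do rewrite big_cons; exact: ucvgD.
Qed.

Lemma useries_tail N B u s : (forall n, (N <= n)%N -> uabs (u n) <= B) ->
  series u @ \oo --> s -> uabs (s - series u N) <= B.
Proof.
move=> uB; apply: (@ucvg_ball N) => n Nn; rewrite sub_series_geq //.
apply: uabs_sum_le => [|i]; first exact: le_trans (uabs_ge0 _) (uB N _).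
by rewrite mem_index_iota => /andP[Ni _] _; exact: uB.
Qed.

Lemma useries_le B u s : (forall n, uabs (u n) <= B) ->
  series u @ \oo --> s -> uabs s <= B.
Proof.
move=> uB /(@useries_tail 0 B) H; rewrite -[s]subr0.
have := H (fun n _ => uB n); by rewrite /series /= big_geq.
Qed.

Lemma useries_geometric_tail t u s N : 0 <= t < 1 ->
  (forall n, uabs (u n) <= t ^+ n) ->
  series u @ \oo --> s -> uabs (s - series u N) <= t ^+ N.
Proof.
move=> /andP[t0 t1] ut; apply: useries_tail => n Nn.
by apply: le_trans (ut n) _; rewrite ler_wiXn2l // ltW.
Qed.

(** With a common ratio, the N-th partial sum differs from [series u N * s'] by terms u_i times a
    tail of v from N - i, each of size at most t^i t^(N-i) = t^N. *)
Lemma ucauchy_product t u v s s' : 0 <= t < 1 ->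
  (forall n, uabs (u n) <= t ^+ n) -> (forall n, uabs (v n) <= t ^+ n) ->
  series u @ \oo --> s -> series v @ \oo --> s' ->
  series (fun n => \sum_(i < n.+1) u i * v (n - i)%N) @ \oo --> s * s'.
Proof.
move=> t01 ut vt us vs'; have /andP[t0 t1] := t01.
have le1 n : t ^+ n <= 1 by rewrite exprn_ile1 // ltW.
apply: (@ucvg_geometric t 1) => // N; rewrite mul1r.
have -> : series (fun n => \sum_(i < n.+1) u i * v (n - i)%N) N =
    \sum_(i < N) u i * series v (N - i)%N.
  rewrite /series /=; elim: N => [|N IHN]; first by rewrite big_geq ?big_ord0.
  rewrite big_nat_recr //= IHN !big_ord_recr /= subnn subSnn big_nat1.
  rewrite addrA -big_split /=; congr (_ + _); apply: eq_bigr => i _.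
  by rewrite subSn 1?ltnW // big_nat_recr //= mulrDr.
apply: (@uabs_triangle (series u N * s')).
  rewrite -mulrBl uabsM -[leRHS]mulr1; apply: ler_pM; rewrite ?uabs_ge0 //.
    exact: useries_geometric_tail.
  by apply: useries_le vs' => n; exact: le_trans (vt n) (le1 n).
rewrite /series /= big_mkord mulr_suml -sumrB; apply: uabs_sum_le => [|i _ _].
  exact: exprn_ge0.
rewrite -mulrBr uabsM -[in leRHS](subnKC (ltnW (ltn_ord i))) exprD.
by rewrite ler_pM ?uabs_ge0 // useries_geometric_tail.
Qed.

(** Strong induction on the index m of the first coefficient not yet known to vanish. At w^(j+1) the
    term of index m is bounded by the tail, which is smaller by a factor |w|^j up to a constant;
    letting j grow kills it. *)
Lemma power_series_eq0 (rho : R) (w : K) (d : nat -> K) :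
  0 < uabs w < 1 -> uabs w < rho ->
  (forall z, uabs z < rho ->
    series (fun n => d n * z ^+ n) @ \oo --> (0 : K)) ->
  forall n, d n = 0.
Proof.
move=> /andP[w0 w1] w_rho d0 m; have [m' le_m'] := ubnP m.
elim: m' m le_m' => // m' IHm m le_m.
have {}IHm i : (i < m)%N -> d i = 0.
  by move=> lt_im; apply: IHm; exact: leq_trans lt_im le_m.
have [N _ HN] := (ucvgP _ _).1 (d0 _ w_rho) _ ltr01.
(* Bounds every |d_n w^n|: the sum covers n < N, and from N on a term is a difference of two partial
   sums of absolute value below 1. *)
pose B : R := 1 + \sum_(i < N) uabs (d i * w ^+ i).
have sum_ge0 : 0 <= \sum_(i < N) uabs (d i * w ^+ i).
  by apply: sumr_ge0 => i _; exact: uabs_ge0.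
have dB n : uabs (d n * w ^+ n) <= B.
  have [lt_nN|le_Nn] := ltnP n N.
    rewrite /B (bigD1 (Ordinal lt_nN)) //= addrCA lerDl addr_ge0 //.
    by apply: sumr_ge0 => i _; exact: uabs_ge0.
  apply: le_trans (_ : 1 <= B); last by rewrite lerDl.
  have -> : d n * w ^+ n = (0 - series (fun n => d n * w ^+ n) n) -
      (0 - series (fun n => d n * w ^+ n) n.+1).
    by rewrite /series /= big_nat_recr //= !sub0r opprK addKr.
  by apply: uabsB_le; apply: ltW; apply: HN => /=; rewrite // ltnW.
have dw0 : d m * w ^+ m = 0.
  apply: ucvg_unique _ (@ucvg_cst 0); apply: (@ucvg_geometric (uabs w) B).
    by rewrite ltW.
  move=> j; rewrite subr0.
  have wj_rho : uabs (w ^+ j.+1) < rho.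
    apply: le_lt_trans w_rho; rewrite uabsX exprS ler_piMr ?uabs_ge0 //.
    by rewrite exprn_ile1 ?uabs_ge0 // ltW.
  have termE n : d n * (w ^+ j.+1) ^+ n = d n * w ^+ n * w ^+ (j * n).
    by rewrite -exprM mulSn exprD mulrA.
  have := useries_tail (N := m.+1) (B := B * uabs w ^+ (j * m.+1)) _
    (d0 _ wj_rho).
  rewrite /series /= big_nat_recr //= big_nat_cond.
  rewrite big1 => [|i /andP[/andP[_ /IHm ->]]]; last first.
    by rewrite mul0r.
  rewrite sub0r add0r uabsN termE uabsM uabsX mulnS exprD mulrA.
  rewrite ler_pM2r ?exprn_gt0 //; apply => n lt_mn.
  rewrite termE uabsM uabsX -mulrA -exprD -mulnS; apply: ler_pM;
    rewrite ?exprn_ge0 ?uabs_ge0 //.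
  by rewrite ler_wiXn2l ?uabs_ge0 ?(ltW w1) // leq_mul2l lt_mn orbT.
apply/eqP; move/eqP: dw0; rewrite mulf_eq0 expf_eq0 -[w == 0]uabs_eq0 gt_eqF //.
by rewrite andbF orbF.
Qed.

Hypothesis complete :
  forall F : set_system K, ProperFilter F -> cauchy F -> cvg F.

Lemma ucauchy t u : 0 <= t < 1 -> (forall n, uabs (u n.+1 - u n) <= t ^+ n) ->
  exists2 s, u @ \oo --> s & forall n, uabs (s - u n) <= t ^+ n.
Proof.
move=> t01 ut; have /andP[t0 t1] := t01.
have utn N n : (N <= n)%N -> uabs (u n - u N) <= t ^+ N.
  elim: n => [|n IHn].
    by rewrite leqn0 => /eqP ->; rewrite subrr uabs0 exprn_ge0.
  rewrite leq_eqVlt => /predU1P[->|]; first by rewrite subrr uabs0 exprn_ge0.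
  rewrite ltnS => le_Nn; apply: (@uabs_triangle (u n)); last exact: IHn.
  by apply: le_trans (ut n) _; rewrite ler_wiXn2l // ltW.
have : cvg (u @ \oo).
  apply: complete; apply/cauchy_exP => e e0.
  have /cvgr0Pnorm_lt/(_ _ e0)[N _ HN] : (fun n => t ^+ n) @ \oo --> (0 : R).
    by apply: cvg_expr; rewrite ger0_norm.
  exists (u N); exists N => //= n Nn; rewrite ballEmdist /=.
  change (uabs (u N - u n) < e); rewrite uabsB.
  apply: le_lt_trans (utn _ _ Nn) _.
  by apply: le_lt_trans (ler_norm _) (HN N _) => /=.
move=> /cvg_ex[s us]; exists s => // n.
by apply: (@ucvg_ball n) us; exact: utn.
Qed.

Lemma useries_cvg t (u : nat -> K) : 0 <= t < 1 ->
  (forall n, uabs (u n) <= t ^+ n) ->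
  exists2 s, series u @ \oo --> s &
    forall n, uabs (s - series u n) <= t ^+ n.
Proof.
move=> t01 ut; apply: ucauchy => // n.
by rewrite /series /= big_nat_recr //= addrAC subrr add0r.
Qed.

End UltrametricAnalysis.

(** * p-adic powers and the fermionic integral *)

Section IntegralPolynomials.
Context {R : realType} {K : ultraField R}.
Implicit Types (P : {poly K}) (x y z : K).

Definition integral_poly P := forall i, uabs P`_i <= 1.

Lemma horner_integral P z : integral_poly P -> uabs z <= 1 -> uabs P.[z] <= 1.
Proof.
move=> P1 z1; rewrite horner_coef; apply: uabs_sum_le => // i _ _.
by rewrite uabsM uabsX mulr_ile1 ?exprn_ge0 ?uabs_ge0 ?exprn_ile1 ?uabs_ge0.
Qed.

Lemma horner_lipschitz P y z : integral_poly P -> uabs y <= 1 -> uabs z <= 1 ->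
  uabs (P.[y] - P.[z]) <= uabs (y - z).
Proof.
move=> P1 y1 z1; rewrite !horner_coef -sumrB; apply: uabs_sum_le => [|i _ _].
  exact: uabs_ge0.
rewrite -mulrBr subrXX mulrCA uabsM ler_piMr ?uabs_ge0 // uabsM.
rewrite mulr_ile1 ?uabs_ge0 //; apply: uabs_sum_le => // j _ _.
by rewrite uabsM !uabsX mulr_ile1 ?exprn_ge0 ?uabs_ge0 ?exprn_ile1 ?uabs_ge0.
Qed.

Lemma ffact_poly_integral n : integral_poly (ffact_poly K n).
Proof.
elim: n => [|n IHn] i; first by rewrite /ffact_poly big_ord0 coef1 uabs_nat_le1.
rewrite ffact_polyS mulrBr coefB coefMX coefMC; apply: uabsB_le.
  by case: i => [|i] //=; rewrite uabs0.
by rewrite uabsM mulr_ile1 ?uabs_ge0 ?uabs_nat_le1.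
Qed.

End IntegralPolynomials.

(** * The absolute value on the integers and the exponential radius *)

Section PadicComplex.
Context {R : realType} {K : ultraField R} {p : nat}.
Hypotheses (p_prime : prime p) (p_odd : odd p) (K_Cp : is_padic_complex p K).
Implicit Types (q t u x y z : K).

Let p_gt2 : (2 < p)%N.
Proof. by rewrite odd_prime_gt2. Qed.

Let pV_lt1 : 0 < (p%:R : R)^-1 < 1.
Proof.
rewrite invr_gt0 ltr0n (ltn_trans _ p_gt2) // invf_lt1.
  by rewrite ltr1n (ltn_trans _ p_gt2).
by rewrite ltr0n (ltn_trans _ p_gt2).
Qed.

(** Bezout gives a with a m - 1 a multiple of p, so |a m| = 1; as neither factor exceeds 1, both
    equal 1. *)
Lemma uabs_coprime m : coprime p m -> uabs (m%:R : K) = 1.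
Proof.
case: m => [|m pm].
  by rewrite /coprime gcdn0 => /eqP p1; move: p_gt2; rewrite p1.
have [a b abE _] := egcdnP p (ltn0Sn m).
have : uabs ((a * m.+1)%:R - 1 : K) < 1.
  rewrite abE gcdnC (eqP pm) natrD addrK natrM uabsM (padic_abs_p K_Cp).
  apply: le_lt_trans (_ : (p%:R : R)^-1 < 1); last by case/andP: pV_lt1.
  by rewrite ler_piMl ?invr_ge0 ?ler0n ?uabs_nat_le1.
move=> /uabs_near1; rewrite natrM uabsM => abm.
apply/eqP; rewrite eq_le uabs_nat_le1 /= -[leLHS]abm.
by rewrite ler_piMl ?uabs_ge0 ?uabs_nat_le1.
Qed.

Lemma uabs_nat n : (0 < n)%N -> uabs (n%:R : K) = (p%:R^-1) ^+ logn p n.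
Proof.
move=> n_gt0; have [m pm {1}->] := pfactor_coprime p_prime n_gt0.
by rewrite natrM natrX uabsM uabsX (uabs_coprime pm) (padic_abs_p K_Cp) mul1r.
Qed.

Lemma padic_pchar0 : [pchar K] =i pred0.
Proof.
apply/pcharf0P => n; have [->|n_gt0] := posnP n; first by rewrite !eqxx.
rewrite -uabs_eq0 uabs_nat // expf_eq0 invr_eq0 pnatr_eq0.
by rewrite [p == 0](gtn_eqF (prime_gt0 p_prime)) andbF.
Qed.

Local Notation r := (exp_radius R p).

(** Lets inequalities about [r] be checked after raising to the power p - 1, away from real
    exponents. *)
Lemma exp_radiusX : r ^+ p.-1 = p%:R^-1.
Proof.
rewrite /exp_radius -powR_mulrn ?powR_ge0 // -powRrM mulNr mulVf.
  by rewrite powR_inv1 ?ler0n.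
by rewrite pnatr_eq0 -lt0n -subn1 subn_gt0 ltnW.
Qed.

Let p1_gt0 : (0 < p.-1)%N. Proof. by rewrite -subn1 subn_gt0 ltnW. Qed.

Lemma exp_radius_gt0 : 0 < r.
Proof. by rewrite powR_gt0 // ltr0n (ltn_trans _ p_gt2). Qed.

Lemma exp_radius_lt1 : r < 1.
Proof.
rewrite -(@ltr_pXn2r _ p.-1) ?nnegrE ?ltW ?exp_radius_gt0 //.
by rewrite exp_radiusX expr1n; case/andP: pV_lt1.
Qed.

(** Strict because p > 2. It allows p to be the point w of [power_series_eq0]. *)
Lemma uabs_p_lt_radius : uabs (p%:R : K) < r.
Proof.
have /andP[pV0 pV1] := pV_lt1.
rewrite (padic_abs_p K_Cp) -(@ltr_pXn2r _ p.-1) //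
  ?nnegrE ?(ltW exp_radius_gt0) ?(ltW pV0) //.
by rewrite exp_radiusX ltr_iXnr // -subn1 ltn_subRL.
Qed.

Lemma exp_radius_le_fact n : r ^+ n.-1 <= uabs (n`!%:R : K).
Proof.
have /andP[pV0 pV1] := pV_lt1.
rewrite -(@ler_pXn2r _ p.-1) //
  ?nnegrE ?exprn_ge0 ?uabs_ge0 ?(ltW exp_radius_gt0) //.
rewrite uabs_nat ?fact_gt0 // exprAC exp_radiusX -exprM mulnC.
by rewrite ler_wiXn2l ?(ltW pV0) ?(ltW pV1) // logn_fact_le.
Qed.

Section ExpTerms.
Variable t : K.
Hypothesis t_lt : uabs t < r.
Let th := uabs t / r.

Lemma ratio_lt1 : 0 <= uabs t / r < 1.
Proof.
rewrite divr_ge0 ?uabs_ge0 ?(ltW exp_radius_gt0) //=.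
by rewrite ltr_pdivrMr ?exp_radius_gt0 // mul1r.
Qed.

Lemma exp_termS_le n : uabs (t ^+ n.+1 / n.+1`!%:R) <= uabs t * th ^+ n.
Proof.
rewrite uabsM uabsX uabsV exprS -mulrA ler_wpM2l ?uabs_ge0 // /th expr_div_n.
rewrite ler_wpM2l ?exprn_ge0 ?uabs_ge0 //.
rewrite lef_pV2 ?posrE ?exprn_gt0 ?exp_radius_gt0 //.
  exact: (exp_radius_le_fact n.+1).
exact: lt_le_trans (exprn_gt0 _ exp_radius_gt0) (exp_radius_le_fact n.+1).
Qed.

Lemma exp_termS_le_uabs n : uabs (t ^+ n.+1 / n.+1`!%:R) <= uabs t.
Proof.
apply: le_trans (exp_termS_le n) _; rewrite ler_piMr ?uabs_ge0 //.
by case/andP: ratio_lt1 => ? ?; rewrite exprn_ile1 // ltW.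
Qed.

Lemma exp_term_le n : uabs (t ^+ n / n`!%:R) <= th ^+ n.
Proof.
case: n => [|n]; first by rewrite expr0 divr1 uabs1.
apply: le_trans (exp_termS_le n) _; rewrite exprS ler_wpM2r //.
  by rewrite exprn_ge0 //; case/andP: ratio_lt1.
rewrite /th ler_peMr ?uabs_ge0 // invf_ge1 ?exp_radius_gt0 //.
by rewrite ltW ?exp_radius_lt1.
Qed.

(** From 1/(n+1) = n!/(n+1)! and |n!| <= 1. The exponent n + 1 so obtained is weakened to n, to fit
    [ucauchy_product]. *)
Lemma log_term_le n : uabs ((-1) ^+ n * t ^+ n.+1 / n.+1%:R) <= th ^+ n.
Proof.
have /andP[th0 th1] := ratio_lt1.
have fE : n.+1%:R^-1 = n`!%:R / n.+1`!%:R :> K.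
  have /pcharf0P nat0 := padic_pchar0.
  by rewrite factS natrM invfM mulrCA mulfV ?mulr1 // nat0 -lt0n fact_gt0.
rewrite fE -mulrA uabsM uabsX uabsN uabs1 expr1n mul1r mulrCA uabsM.
rewrite (@le_trans _ _ (th ^+ n.+1)) //; last by rewrite ler_wiXn2l ?(ltW th1).
apply: le_trans (exp_term_le n.+1); rewrite ler_piMl ?uabs_ge0 ?uabs_nat_le1 //.
Qed.

Lemma bin_poly_coef_term_le n k : uabs ((bin_poly K n)`_k * t ^+ n) <= th ^+ n.
Proof.
apply: le_trans (exp_term_le n).
rewrite coefZ mulrAC [_ * t ^+ n]mulrC [leLHS]uabsM.
by rewrite ler_piMr ?uabs_ge0 // ffact_poly_integral.
Qed.

Lemma bin_poly_horner_term_le n z : uabs z <= 1 ->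
  uabs ((bin_poly K n).[z] * t ^+ n) <= th ^+ n.
Proof.
move=> z1; apply: le_trans (exp_term_le n).
rewrite hornerZ mulrAC [_ * t ^+ n]mulrC [leLHS]uabsM.
by rewrite ler_piMr ?uabs_ge0 // horner_integral //; exact: ffact_poly_integral.
Qed.

End ExpTerms.

Let complete := padic_complete K_Cp.

(** * The binomial series of u^z *)

Section BinomialSeries.
Variable u : K.
Hypothesis u_near1 : uabs (u - 1) < r.
Let t := u - 1.
Let th := uabs t / r.
Let th01 : 0 <= th < 1. Proof. exact: ratio_lt1. Qed.

Let A k n : K := (bin_poly K n)`_k * t ^+ n.

Let A_le k n : uabs (A k n) <= th ^+ n.
Proof. exact: bin_poly_coef_term_le. Qed.

Let sumA k : K := limn (series (A k)).

Let cvgA k : series (A k) @ \oo --> sumA k.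
Proof.
have [s As _] := useries_cvg complete th01 (A_le k).
by rewrite /sumA (ucvg_lim As).
Qed.

Let cvg_log :
  series (fun n => (-1) ^+ n * t ^+ n.+1 / n.+1%:R) @ \oo --> ulog u.
Proof.
have [s Ls _] := useries_cvg complete th01 (log_term_le u_near1).
by rewrite /ulog (ucvg_lim Ls).
Qed.

Let sumA0 : sumA 0 = 1.
Proof.
have A0 n : A 0 n = (n == 0)%:R.
  rewrite /A -horner_coef0 [_.[0]](bin_poly_nat padic_pchar0 0) bin0n.
  by case: n => [|n]; rewrite ?mul1r ?expr0 ?mul0r.
apply: ucvg_unique (@cvgA 0) _; apply: (@ucvg_geometric _ _ th 1) => // n.
rewrite mul1r /series /=; case: n => [|n].
  by rewrite big_geq // subr0 uabs1 expr0.
rewrite big_nat_recl // A0 big1 ?addr0 ?subrr ?uabs0 ?exprn_ge0 //.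
by case/andP: th01.
Qed.

(** Taking the coefficient of z^k in [deriv_bin_poly] makes the left side the Cauchy product of
    [A k] with the logarithmic series. *)
Let sumAS k : k.+1%:R * sumA k.+1 = sumA k * ulog u.
Proof.
have := ucauchy_product th01 (A_le k) (log_term_le u_near1) (@cvgA k) cvg_log.
apply: ucvg_unique.
(* The index shifts by one: [A k.+1 0] is 0, as [bin_poly 0] is constant. *)
have -> : series (fun n => \sum_(i < n.+1)
    A k i * ((-1) ^+ (n - i) * t ^+ (n - i).+1 / (n - i).+1%:R)) =
    (fun n => k.+1%:R * series (A k.+1) n.+1).
  apply/funext => N; rewrite /series /= big_nat_recl //=.
  rewrite [A k.+1 0](_ : _ = 0); last first.
    by rewrite /A /bin_poly /ffact_poly big_ord0 coefZ coef1 mulr0 mul0r.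
  rewrite add0r mulr_sumr; apply: eq_bigr => n _.
  rewrite /A mulrA mulr_natl -coef_deriv (deriv_bin_poly padic_pchar0).
  rewrite coef_sum mulr_suml; apply: eq_bigr => i _.
  rewrite [in RHS]coefZ subSS -subSn -1?ltnS //.
  rewrite -[in t ^+ n.+1](@subnKC i n.+1) 1?ltnW // exprD.
  set c := (-1) ^+ _; set b := (bin_poly K i)`_k; set d := _%:R^-1.
  ring.
apply: ucvgZ; apply: (@ucvg_geometric _ _ th 1) => // n.
have /andP[th0 th1] := th01.
apply: le_trans (useries_geometric_tail n.+1 th01 (A_le _) (@cvgA _)) _.
by rewrite mul1r ler_wiXn2l // ltW.
Qed.

Let sumAE k : sumA k = ulog u ^+ k / k`!%:R.
Proof.
have /pcharf0P nat0 := padic_pchar0.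
elim: k => [|k IHk]; first by rewrite sumA0 expr0 divr1.
have k0 : k.+1%:R != 0 :> K by rewrite nat0.
apply: (mulfI k0); rewrite sumAS IHk exprSr factS natrM invfM.
by rewrite mulrCA mulVKf // mulrAC.
Qed.

(* With [A k n] the coefficient of z^k in the n-th term, summing over n first
   gives the exponential series of z log u, because sum_n A k n = (log u)^k / k!
   by [deriv_bin_poly]. *)
Lemma upow_binomial z : uabs z <= 1 ->
  series (fun n => (bin_poly K n).[z] * t ^+ n) @ \oo --> upow u z.
Proof.
move=> z1; have /andP[th0 th1] := th01.
have H_le n := bin_poly_horner_term_le u_near1 n z1.
have [h hs _] := useries_cvg complete th01 H_le.
suff : series (fun n => (z * ulog u) ^+ n / n`!%:R) @ \oo --> h.
  by move/ucvg_lim => uE; rewrite /upow /uexp uE.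
apply: (@ucvg_geometric _ _ th 1) => // N; rewrite mul1r.
apply: uabs_triangle (useries_geometric_tail N th01 H_le hs) _.
(* For n < N the degree of [bin_poly n] is below N, so the rearrangement is a finite N by N sum;
   each inner sum is then within th^N of [sumA k]. *)
have -> : series (fun n => (bin_poly K n).[z] * t ^+ n) N =
    \sum_(k < N) z ^+ k * series (A k) N.
  rewrite /series /= !big_mkord.
  under [RHS]eq_bigr do rewrite big_mkord mulr_sumr.
  rewrite exchange_big; apply: eq_bigr => n _ /=.
  rewrite (@horner_coef_wide _ N) ?mulr_suml; last first.
    by apply: leq_trans (size_scale_leq _ _) _; rewrite size_ffact_poly.
  by apply: eq_bigr => k _; rewrite /A mulrA [z ^+ k * _]mulrC.
rewrite /series /= big_mkord -sumrB; apply: uabs_sum_le => [|k _ _].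
  exact: exprn_ge0.
rewrite exprMn -mulrA -sumAE -mulrBr uabsM uabsX uabsB -[leRHS]mul1r.
apply: ler_pM; rewrite ?exprn_ge0 ?uabs_ge0 ?exprn_ile1 ?uabs_ge0 //.
exact: useries_geometric_tail.
Qed.

Lemma upow_nat m : upow u m%:R = u ^+ m.
Proof.
have h := upow_binomial (uabs_nat_le1 m).
apply/eqP; rewrite -subr_eq0 -uabs_eq0 eq_le uabs_ge0 andbT.
apply: (ucvg_ball (N := m.+1)) h => n lt_mn.
rewrite [X in X - _](_ : _ = u ^+ m) ?subrr ?uabs0 //.
rewrite /series /= (@big_cat_nat _ _ _ m.+1) //= [X in _ + X]big_nat_cond.
rewrite [X in _ + X]big1 ?addr0 => [|i /andP[/andP[lt_mi _] _]]; last first.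
  by rewrite (bin_poly_nat padic_pchar0) bin_small ?mul0r.
rewrite -[u in RHS](subrK 1) addrC exprDn big_mkord; apply: eq_bigr => i _.
by rewrite (bin_poly_nat padic_pchar0) expr1n mul1r mulr_natl.
Qed.

(** The constant term of the binomial series cancels in the difference, and for n >= 1 the factor
    t^n / n! is at most |t|. *)
Lemma upow_lipschitz y z : uabs y <= 1 -> uabs z <= 1 ->
  uabs (upow u y - upow u z) <= uabs t * uabs (y - z).
Proof.
move=> y1 z1; have := ucvgB (upow_binomial y1) (upow_binomial z1).
rewrite -[X in uabs X]subr0; apply: (ucvg_ball (N := 0)) => N _.
rewrite subr0 /series /= -sumrB; apply: uabs_sum_le => [|n _ _].
  by rewrite mulr_ge0 ?uabs_ge0.
rewrite -mulrBl !hornerZ -mulrBr mulrAC [_ * t ^+ n]mulrC [leLHS]uabsM.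
case: n => [|n].
  by rewrite /ffact_poly big_ord0 !hornerC subrr uabs0 mulr0 mulr_ge0 ?uabs_ge0.
apply: ler_pM; rewrite ?uabs_ge0 ?exp_termS_le_uabs //.
by apply: horner_lipschitz => //; exact: ffact_poly_integral.
Qed.

End BinomialSeries.

(** With both constants equal to 1 the class is stable under products, integral polynomials and
    [upow u]. *)
Definition bounded_lipschitz (f : nat -> K) :=
  (forall y : nat, uabs (f y) <= 1) /\
  (forall y m : nat, uabs (f (y + m)%N - f y) <= uabs (m%:R : K)).

Lemma bounded_lipschitzM (f g : nat -> K) :
  bounded_lipschitz f -> bounded_lipschitz g ->
  bounded_lipschitz (fun y : nat => f y * g y).
Proof.
move=> [f1 fl] [g1 gl]; split=> [y|y m].
  by rewrite uabsM mulr_ile1 ?uabs_ge0.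
apply: (@uabs_triangle _ _ (f (y + m)%N * g y)).
  rewrite -mulrBr uabsM; apply: le_trans (gl y m).
  by rewrite ler_piMl ?uabs_ge0.
rewrite -mulrBl uabsM; apply: le_trans (fl y m).
by rewrite ler_piMr ?uabs_ge0.
Qed.

Lemma bounded_lipschitz_horner P (f : nat -> K) :
  integral_poly P -> bounded_lipschitz f ->
  bounded_lipschitz (fun y : nat => P.[f y]).
Proof.
move=> P1 [f1 fl]; split=> [y|y m]; first exact: horner_integral.
by apply: le_trans (fl y m); exact: horner_lipschitz.
Qed.

Lemma upow_near1 u z : uabs (u - 1) < r -> uabs z <= 1 ->
  uabs (upow u z - 1) < 1.
Proof.
move=> u1 z1; rewrite -(expr0 u) -upow_nat //.
apply: le_lt_trans (upow_lipschitz u1 z1 (uabs_nat_le1 0)) _; rewrite subr0.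
apply: le_lt_trans exp_radius_lt1; apply: ltW.
by apply: le_lt_trans u1; rewrite ler_piMr ?uabs_ge0.
Qed.

Lemma bounded_lipschitz_upow u (f : nat -> K) :
  uabs (u - 1) < r -> bounded_lipschitz f ->
  bounded_lipschitz (fun y : nat => upow u (f y)).
Proof.
move=> u1 [f1 fl]; split=> [y|y m].
  by rewrite (uabs_near1 (upow_near1 u1 (f1 y))).
apply: le_trans (upow_lipschitz u1 (f1 _) (f1 _)) _.
rewrite -[leRHS]mul1r; apply: ler_pM; rewrite ?uabs_ge0 //.
by rewrite ltW // (lt_trans u1) ?exp_radius_lt1.
Qed.

Lemma bounded_lipschitz_natr : bounded_lipschitz (fun y : nat => y%:R).
Proof.
by split=> [y|y m]; [exact: uabs_nat_le1 | rewrite natrD addrAC subrr add0r].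
Qed.

Lemma bounded_lipschitz_expr u : uabs (u - 1) < r ->
  bounded_lipschitz (fun y : nat => u ^+ y).
Proof.
move=> u1; have := bounded_lipschitz_upow u1 bounded_lipschitz_natr.
by under eq_fun do rewrite upow_nat //.
Qed.

(** * Convergence and sup-norm bound of the fermionic sums *)

Section FermionicIntegral.
Variable q : K.
Hypothesis q_near1 : uabs (q - 1) < r.

Definition fermionic_sum (f : nat -> K) N : K :=
  (qnumberN q (p ^ N))^-1 * \sum_(0 <= y < p ^ N) f y * (- q) ^+ y.

Let odd_pX N : odd (p ^ N). Proof. by rewrite oddX p_odd orbT. Qed.

(** Here 1 + q^m = 2 (1 + (q^m - 1) / 2), with 2 a unit and |q^m - 1| < 1. *)
Let uabs_1DqX m : uabs (1 + q ^+ m) = 1.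
Proof.
have n2 : uabs (2%:R : K) = 1 by rewrite uabs_coprime // coprimen2.
have qm : uabs (q ^+ m - 1) < 1.
  by rewrite -upow_nat // upow_near1 // uabs_nat_le1.
have -> : 1 + q ^+ m = 2%:R * (1 + (q ^+ m - 1) / 2%:R).
  have two_neq0 : (2%:R : K) != 0 by rewrite -uabs_eq0 n2 oner_eq0.
  move: (q ^+ m) => z; rewrite mulrDr mulr1 [2%:R * _]mulrC divfK // addrCA.
  by rewrite -[2%:R]/(1 + 1) -addrA subrr addr0 addrC.
rewrite uabsM n2 mul1r uabs_near1 // addrAC subrr add0r uabsM uabsV n2.
by rewrite invr1 mulr1.
Qed.

Lemma fermionic_sumE f N : fermionic_sum f N =
  (1 + q) * (1 + q ^+ (p ^ N))^-1 *
  \sum_(0 <= y < p ^ N) f y * q ^+ y * (-1) ^+ y.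
Proof.
rewrite /fermionic_sum /qnumberN exprNn -signr_odd odd_pX expr1 mulN1r opprK.
rewrite invf_div; congr (_ * _); apply: eq_bigr => y _.
by rewrite [RHS]mulrAC (exprNn q) mulrA.
Qed.

Lemma fermionic_sum_le f N B : 0 <= B -> (forall y : nat, uabs (f y) <= B) ->
  uabs (fermionic_sum f N) <= B.
Proof.
move=> B0 fB; rewrite fermionic_sumE !uabsM uabsV uabs_1DqX.
rewrite -[q in 1 + q]expr1 uabs_1DqX invr1 !mul1r.
apply: uabs_sum_le => // y _ _; rewrite !uabsM !uabsX uabsN uabs1 expr1n mulr1.
by rewrite (uabs_near1 (lt_trans q_near1 exp_radius_lt1)) expr1n mulr1.
Qed.

Let pVX_ge0 N : 0 <= (p%:R^-1 : R) ^+ N.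
Proof. by rewrite exprn_ge0 ?invr_ge0 ?ler0n. Qed.

(* As p is odd, the p blocks of length p^N come with alternating signs, and
   all but one cancel up to an error of size |p^N|. *)
Let alternating_sum_step (g : nat -> K) N : bounded_lipschitz g ->
  uabs (\sum_(0 <= y < p ^ N.+1) g y * (-1) ^+ y -
        \sum_(0 <= y < p ^ N) g y * (-1) ^+ y) <= p%:R^-1 ^+ N.
Proof.
move=> [g1 gl]; rewrite expnS big_nat_mul.
set S := \sum_(0 <= y < p ^ N) _.
have -> : S = \sum_(0 <= i < p) (-1) ^+ i * S.
  rewrite -mulr_suml -[LHS]mul1r; congr (_ * _).
  have -> : forall m, \sum_(0 <= i < m) (-1) ^+ i = (odd m)%:R :> K.
    elim=> [|m IHm]; first by rewrite big_geq.
    rewrite big_nat_recr //= IHm -signr_odd.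
    by case: (odd m); rewrite ?expr1 ?subrr ?expr0 ?add0r.
  by rewrite p_odd.
rewrite -sumrB; apply: uabs_sum_le => // i _ _.
rewrite mulSn -{1}[(i * p ^ N)%N]add0n big_addn addnK.
rewrite mulr_sumr -sumrB; apply: uabs_sum_le => // y _ _.
have -> : (-1) ^+ (y + i * p ^ N) = (-1) ^+ i * (-1) ^+ y :> K.
  rewrite exprD mulrC -(signr_odd _ (i * _)) oddM odd_pX andbT signr_odd.
  by [].
rewrite mulrCA -mulrBr -mulrBl !uabsM !uabsX uabsN uabs1 !expr1n mul1r mulr1.
apply: le_trans (gl _ _) _; rewrite natrM natrX uabsM uabsX (padic_abs_p K_Cp).
by rewrite ler_piMl // uabs_nat_le1.
Qed.

(** As q^y is itself bounded Lipschitz, it joins the integrand and only the sign (-1)^y remains as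
    weight. *)
Lemma fermionic_sum_cvg f : bounded_lipschitz f ->
  exists s : K, fermionic_sum f @ \oo --> s.
Proof.
move=> gf; have pV01 : 0 <= (p%:R : R)^-1 < 1.
  by case/andP: pV_lt1 => /ltW -> ->.
suff H N : uabs (fermionic_sum f N.+1 - fermionic_sum f N) <= p%:R^-1 ^+ N.
  by have [s fs _] := ucauchy complete pV01 H; exists s.
have gq := bounded_lipschitz_expr q_near1.
have gfq := bounded_lipschitzM gf gq.
have qDX_neq0 m : 1 + q ^+ m != 0 by rewrite -uabs_eq0 uabs_1DqX oner_eq0.
rewrite !fermionic_sumE -!mulrA -mulrBr uabsM -[q in 1 + q]expr1 uabs_1DqX.
rewrite mul1r.
set S1 := \sum_(0 <= y < p ^ N.+1) _; set S := \sum_(0 <= y < p ^ N) _.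
(* The sum and the normalizer are changed one at a time; the second change is governed by q^(p^N) -
   q^(p^(N+1)), of size at most |p^N|. *)
apply: (@uabs_triangle _ _ ((1 + q ^+ (p ^ N.+1))^-1 * S)).
  rewrite -mulrBr uabsM uabsV uabs_1DqX invr1 mul1r.
  exact: alternating_sum_step.
have -> : (1 + q ^+ (p ^ N.+1))^-1 * S - (1 + q ^+ (p ^ N))^-1 * S =
    (q ^+ (p ^ N) - q ^+ (p ^ N.+1)) *
    ((1 + q ^+ (p ^ N.+1))^-1 * (1 + q ^+ (p ^ N))^-1 * S).
  by field; rewrite !qDX_neq0.
rewrite !uabsM !uabsV !uabs_1DqX invr1 !mul1r -[leRHS]mulr1.
apply: ler_pM; rewrite ?uabs_ge0 //; last first.
  apply: uabs_sum_le => // y _ _.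
  by rewrite uabsM uabsX uabsN uabs1 expr1n mulr1; case: gfq.
have le_p : (p ^ N <= p ^ N.+1)%N by rewrite leq_exp2l // prime_gt1.
rewrite uabsB -[in q ^+ (p ^ N.+1)](subnKC le_p).
apply: le_trans (gq.2 _ _) _.
rewrite natrB // expnS natrM -[X in _ - X]mul1r -mulrBl uabsM natrX uabsX.
rewrite (padic_abs_p K_Cp) ler_piMl //.
by rewrite uabsB_le ?uabs_nat_le1 ?uabs1.
Qed.

Lemma fermionic_int_cvg (f : K -> K) :
  bounded_lipschitz (fun y : nat => f y%:R) ->
  fermionic_sum (fun y : nat => f y%:R) @ \oo --> fermionic_int p q f.
Proof.
by move=> /fermionic_sum_cvg[s fs]; rewrite /fermionic_int (ucvg_lim fs).
Qed.

Lemma fermionic_sumB f g N : fermionic_sum (fun y : nat => f y - g y) N =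
  fermionic_sum f N - fermionic_sum g N.
Proof.
rewrite /fermionic_sum -mulrBr -sumrB; congr (_ * _).
by apply: eq_bigr => y _; rewrite mulrBl.
Qed.

Lemma fermionic_sum_linear (I : Type) (s : seq I) (c : I -> K)
    (f : I -> nat -> K) N :
  fermionic_sum (fun y : nat => \sum_(i <- s) c i * f i y) N =
  \sum_(i <- s) c i * fermionic_sum (f i) N.
Proof.
rewrite /fermionic_sum; under eq_bigr do rewrite mulr_suml.
rewrite exchange_big mulr_sumr; apply: eq_bigr => i _.
rewrite [RHS]mulrCA; congr (_ * _); rewrite mulr_sumr; apply: eq_bigr => y _.
by rewrite mulrA.
Qed.

End FermionicIntegral.

(** The constant |q - 1| of [upow q] cancels the denominator; for q = 1 the function is the
    identity. *)
Lemma qnumber_lipschitz q y z :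
  uabs (q - 1) < r -> uabs y <= 1 -> uabs z <= 1 ->
  uabs (qnumber q y - qnumber q z) <= uabs (y - z).
Proof.
move=> q1 y1 z1; rewrite /qnumber; have [//|q_neq1] := eqVneq q 1.
have q1_gt0 : 0 < uabs (q - 1).
  by rewrite lt_neqAle uabs_ge0 eq_sym uabs_eq0 subr_eq0 q_neq1.
rewrite -mulrBl opprB addrA subrK uabsM uabsV ler_pdivrMr // mulrC.
exact: upow_lipschitz.
Qed.

Lemma qnumber0 q : uabs (q - 1) < r -> qnumber q 0 = 0.
Proof.
move=> q1; rewrite /qnumber; case: eqP => // _.
by rewrite (upow_nat q1 0) expr0 subrr mul0r.
Qed.

Lemma bounded_lipschitz_qnumber q x : uabs (q - 1) < r -> uabs x <= 1 ->
  bounded_lipschitz (fun y : nat => qnumber q (x + y%:R)).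
Proof.
move=> q1 x1; have xy1 (y : nat) : uabs (x + y%:R) <= 1.
  by rewrite uabsD_le ?uabs_nat_le1.
split=> [y|y m]; last first.
  apply: le_trans (qnumber_lipschitz q1 (xy1 _) (xy1 _)) _.
  by rewrite [X in uabs X](_ : _ = m%:R) // natrD; ring.
rewrite -[qnumber _ _]subr0 -(qnumber0 q1).
apply: le_trans (qnumber_lipschitz q1 (xy1 _) _) _; first by rewrite uabs0.
by rewrite subr0.
Qed.

(** * Integrals of falling factorials and the generating function *)

Section Changhee.
Variables q x : K.
Hypotheses (q_near1 : uabs (q - 1) < r) (x_le1 : uabs x <= 1).

Let a (y : nat) : K := qnumber q (x + y%:R).
Let good_a : bounded_lipschitz a. Proof. exact: bounded_lipschitz_qnumber. Qed.

Let ffact_int n : K :=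
  fermionic_int p q (fun y => (ffact_poly K n).[qnumber q (x + y)]).

Let ffact_int_cvg n :
  fermionic_sum q (fun y : nat => (ffact_poly K n).[a y]) @ \oo --> ffact_int n.
Proof.
apply: (fermionic_int_cvg q_near1); apply: bounded_lipschitz_horner good_a.
exact: ffact_poly_integral.
Qed.

(** Cutting the binomial series at N costs at most (|t| / r)^N at every y, hence as much in the M-th
    fermionic sum for every M. Letting M grow, then N, gives the claim. *)
Lemma ffact_int_changhee_gen : qChanghee_gen p q x ffact_int.
Proof.
move=> t t_lt; have t1 : uabs (1 + t - 1) < r by rewrite addrAC subrr add0r.
have th01 := ratio_lt1 t_lt; have /andP[th0 _] := th01.
have hF := fermionic_int_cvg
  (f := fun z => upow (1 + t) (qnumber q (x + z))) q_near1
  (bounded_lipschitz_upow t1 good_a).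
apply: (@ucvg_geometric _ _ (uabs t / r) 1) => // N; rewrite mul1r.
rewrite -[X in uabs X]subr0.
have hS : (fun M => \sum_(0 <= n < N) (t ^+ n / n`!%:R) *
    fermionic_sum q (fun y : nat => (ffact_poly K n).[a y]) M) @ \oo -->
    series (fun n => ffact_int n * (t ^+ n / n`!%:R)) N.
  rewrite /series /=; under [X in _ --> X]eq_bigr do rewrite mulrC.
  by apply: ucvg_sum => n; apply: ucvgZ; exact: ffact_int_cvg.
apply: (ucvg_ball (N := 0)) (ucvgB hF hS) => M _; rewrite subr0.
rewrite -fermionic_sum_linear -fermionic_sumB.
apply: fermionic_sum_le => // [|y]; first exact: exprn_ge0.
have hb := upow_binomial t1 (good_a.1 y).
have -> : \sum_(0 <= n < N) t ^+ n / n`!%:R * (ffact_poly K n).[a y] =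
    series (fun n => (bin_poly K n).[a y] * (1 + t - 1) ^+ n) N.
  rewrite /series /=; apply: eq_bigr => n _.
  rewrite hornerZ [1 + t - 1]addrAC subrr add0r; ring.
apply: useries_geometric_tail hb => // n.
rewrite -[t in leRHS](_ : 1 + t - 1 = t); last by rewrite addrAC subrr add0r.
by apply: bin_poly_horner_term_le => //; case: good_a.
Qed.

(** [get] selects from a set of sequences, so that set must be shown to be a singleton: two members
    differ by a power series vanishing on the whole disc. *)
Lemma qChangheeE n : qChanghee p n q x =
  fermionic_int p q (fun y => (ffact_poly K n).[qnumber q (x + y)]).
Proof.
rewrite /qChanghee (_ : get _ = ffact_int) //; apply: get_unique.
  exact: ffact_int_changhee_gen.
move=> c c_gen; apply/funext => k; apply/eqP; rewrite -subr_eq0.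
have /pcharf0P nat0 := padic_pchar0.
have k0 : k`!%:R != 0 :> K by rewrite nat0 -lt0n fact_gt0.
rewrite -[c k - _](divfK k0).
suff -> : forall n, (c n - ffact_int n) / n`!%:R = 0 by rewrite mul0r.
have p01 : 0 < uabs (p%:R : K) < 1 by rewrite (padic_abs_p K_Cp).
apply: (power_series_eq0 p01 uabs_p_lt_radius) => z z_lt.
have := ucvgB (c_gen z z_lt) (ffact_int_changhee_gen z_lt); rewrite subrr.
suff -> : series (fun n => (c n - ffact_int n) / n`!%:R * z ^+ n) =
    (fun N => series (fun n => c n * (z ^+ n / n`!%:R)) N -
              series (fun n => ffact_int n * (z ^+ n / n`!%:R)) N) by [].
apply/funext => N; rewrite /series /= -sumrB; apply: eq_bigr => i _.
by rewrite -mulrBl mulrAC mulrA.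
Qed.

Lemma qEuler_Changhee n :
  qEuler p n q x = \sum_(0 <= k < n.+1) qChanghee p k q x * Stirling2 n k.
Proof.
have good_an : bounded_lipschitz (fun y : nat => a y ^+ n).
  have := bounded_lipschitz_horner (P := 'X^n) _ good_a.
  under eq_fun do rewrite hornerXn; apply => i.
  by rewrite coefXn uabs_nat_le1.
apply: ucvg_unique (fermionic_int_cvg (f := fun z => qnumber q (x + z) ^+ n)
  q_near1 good_an) _.
(* The expansion in falling factorials is finite, so it commutes with the sums and with their
   limit. *)
have -> : fermionic_sum q (fun y : nat => a y ^+ n) = fun N =>
    \sum_(0 <= k < n.+1) Stirling2 n k *
      fermionic_sum q (fun y : nat => (ffact_poly K k).[a y]) N.
  apply/funext => N; rewrite -fermionic_sum_linear; congr (fermionic_sum q _ N).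
  apply/funext => y; rewrite -hornerXn (expr_ffact_poly padic_pchar0).
  by rewrite horner_sum big_mkord; apply: eq_bigr => k _; rewrite hornerZ.
under [X in _ --> X]eq_bigr do rewrite mulrC qChangheeE.
by apply: ucvg_sum => k; apply: ucvgZ; exact: ffact_int_cvg.
Qed.

End Changhee.
End PadicComplex.

Theorem theorem2 (R : realType) (p : nat) (K : ultraField R) (q x : K)
    (p_prime : prime p) (p_odd : odd p) (K_Cp : is_padic_complex p K)
    (hq : uabs (1 - q) < exp_radius R p) (hx : Zp_in x) (n : nat) :
  qEuler p n q x = \sum_(0 <= k < n.+1) qChanghee p k q x * Stirling2 n k.
Proof. by case: hx => _ x1; apply: qEuler_Changhee => //; rewrite uabsB. Qed.
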